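(* Let $Q$ be a finite group acting on a group $G$ by group automorphisms and let $A$ be an abelian group with trivial actions. If $G$ is finite, then $H_i^Q(G;A)$ is annihilated by $|G|$ for all $i>0$.
   Context: $C_\bullet(G)$ is the (unnormalized) bar complex: $C_i(G)$ is the free abelian group on symbols $[g_1|\cdots|g_i]$ with $g_j\in G$, with boundary $d[g_1|\cdots|g_i]=[g_2|\cdots|g_i]+\sum_{k=1}^{i-1}(-1)^k[g_1|\cdots|g_kg_{k+1}|\cdots|g_i]+(-1)^i[g_1|\cdots|g_{i-1}]$. Set $C_\bullet(G;A)=C_\bullet(G)\otimes A$ with boundary $d\otimes 1$. $Q$ acts on $C_\bullet(G;A)$ by $q([g_1|\cdots|g_i]\otimes a)=[q(g_1)|\cdots|q(g_i)]\otimes a$, and $C_\bullet(G;A)^Q$ is the subcomplex of $Q$-invariant chains. Define $H_\bullet^Q(G;A)$ as the homology of $C_\bullet(G;A)^Q$. *)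

(* Defs.v *)
From HB Require Import structures.
From mathcomp Require Import all_boot all_order all_fingroup all_algebra.
From mathcomp Require Import finmap boolp.
From mathcomp Require Import monalg.

Set Implicit Arguments.
Unset Strict Implicit.
Unset Printing Implicit Defensive.

Import GRing.Theory.
Local Open Scope ring_scope.

(* Left actions of Q on G by group automorphisms: each [aut_act q] is bijective,
   with inverse [aut_act q^-1].  (The actions of fingroup/action.v act on the
   right.) *)
Record autAction (Q G : groupType) := AutAction {
  aut_act :> Q -> G -> G;
  aut_act1 : forall g, aut_act 1%g g = g;
  aut_actM : forall p q g, aut_act (p * q)%g g = aut_act p (aut_act q g);
  aut_actMg : forall q g h, aut_act q (g * h)%g = (aut_act q g * aut_act q h)%g
}.

Section LinearExtension.
Variables (K : choiceType) (A B : zmodType).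

(* {malg A[K]} is the group of finitely supported functions K -> A, that is
   Z[K] (x) A, in which << a *g k >> is k (x) a.  [malg_ext f] is the additive
   map sending k (x) a to f k a. *)
Definition malg_ext (f : K -> {additive A -> B}) (c : {malg A[K]}) : B :=
  \sum_(k <- msupp c) f k c@_k.

Lemma malg_extEw f (c : {malg A[K]}) (D : {fset K}) :
  {subset msupp c <= D} -> malg_ext f c = \sum_(k <- D) f k c@_k.
Proof.
move=> sD; rewrite /malg_ext; apply: big_fset_incl; first exact/fsubsetP.
by move=> k _ kNc; rewrite mcoeff_outdom ?raddf0.
Qed.

Lemma malg_ext_is_zmod_morphism f : zmod_morphism (malg_ext f).
Proof.
move=> c e; pose D := (msupp c `|` msupp e)%fset.
rewrite !(@malg_extEw f _ D).
- by rewrite -sumrB; apply: eq_bigr => k _; rewrite mcoeffB raddfB.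
- by move=> k ke; rewrite in_fsetU ke orbT.
- by move=> k kc; rewrite in_fsetU kc.
- by move=> k; apply/fsubsetP/msuppB_le.
Qed.

HB.instance Definition _ f :=
  GRing.isZmodMorphism.Build {malg A[K]} B (malg_ext f)
    (malg_ext_is_zmod_morphism f).

Lemma malg_extU f k a : malg_ext f << a *g k >> = f k a.
Proof.
rewrite (@malg_extEw f _ [fset k]%fset) ?big_seq_fset1 ?mcoeffUU //.
by apply/fsubsetP/msuppU_le.
Qed.

(* The element x (x) a of Z[K] (x) A. *)
Definition malg_tensor (x : {malg int[K]}) (a : A) : {malg A[K]} :=
  \sum_(k <- msupp x) << a *~ x@_k *g k >>.

Lemma malg_tensor_is_zmod_morphism x : zmod_morphism (malg_tensor x).
Proof.
by move=> a b; rewrite -sumrB; apply: eq_bigr => k _; rewrite mulrzBl raddfB.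
Qed.

HB.instance Definition _ x :=
  GRing.isZmodMorphism.Build A {malg A[K]} (malg_tensor x)
    (malg_tensor_is_zmod_morphism x).

End LinearExtension.

(* C_i(G; A) = C_i(G) (x) A.  The bar symbol [g_1|...|g_i] is the tuple
   (g_1, ..., g_i); entries are numbered from 0 in the code. *)
Notation chain G A i := {malg A[i.-tuple G]}.

Section BarComplex.
Variable G : groupType.

(* [g_2|...|g_(n+1)], [g_1|...|g_n], and [g_1|...|g_k g_(k+1)|...|g_(n+1)]
   with k = j + 1. *)
Definition bar_first n (g : n.+1.-tuple G) : n.-tuple G :=
  [tuple tnth g (lift ord0 k) | k < n].

Definition bar_last n (g : n.+1.-tuple G) : n.-tuple G :=
  [tuple tnth g (widen_ord (leqnSn n) k) | k < n].

Definition bar_mul n (g : n.+1.-tuple G) (j : 'I_n) : n.-tuple G :=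
  [tuple if (k < j)%N then tnth g (widen_ord (leqnSn n) k)
         else if k == j
              then (tnth g (widen_ord (leqnSn n) k) * tnth g (lift ord0 k))%g
              else tnth g (lift ord0 k)
  | k < n].

Definition bar_d n (g : n.+1.-tuple G) : chain G int n :=
  << bar_first g >> + \sum_(j < n) << (-1) ^+ j.+1 *g bar_mul g j >>
    + << (-1) ^+ n.+1 *g bar_last g >>.

Variable A : zmodType.

(* d (x) 1 : C_i(G; A) -> C_(i-1)(G; A); it vanishes for i = 0, where the
   codomain C_0(G; A) stands for the zero group C_(-1)(G; A). *)
Definition boundary (i : nat) : chain G A i -> chain G A i.-1 :=
  match i with
  | 0 => fun=> 0
  | n.+1 => malg_ext (fun g : n.+1.-tuple G => malg_tensor (bar_d g))
  end.

Lemma boundary_is_zmod_morphism i : zmod_morphism (@boundary i).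
Proof. by case: i => [|n] c e; [rewrite subrr | exact: raddfB]. Qed.

HB.instance Definition _ i :=
  GRing.isZmodMorphism.Build (chain G A i) (chain G A i.-1) (@boundary i)
    (@boundary_is_zmod_morphism i).

End BarComplex.

Arguments boundary {G A i} _ : simpl never.

Section EquivariantHomology.
Variables (Q : finGroupType) (G : groupType) (to : autAction Q G).
Variables (A : zmodType) (i : nat).

Definition chain_act (q : Q) : chain G A i -> chain G A i :=
  malg_ext (fun g : i.-tuple G => mkmalgU (map_tuple (to q) g)).

HB.instance Definition _ q := GRing.Additive.on (chain_act q).

Definition inv_chain : {pred chain G A i} :=
  [pred c | [forall q : Q, chain_act q c == c]].

Definition inv_cycle : {pred chain G A i} :=
  [pred c | (c \in inv_chain) && (boundary c == 0)].

Lemma inv_cycle_zmod_closed : zmod_closed inv_cycle.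
Proof.
split=> [|c e]; rewrite !inE.
  by rewrite raddf0 eqxx andbT; apply/forallP => q; rewrite raddf0.
move=> /andP[/forallP ic /eqP dc] /andP[/forallP ie /eqP de].
apply/andP; split; last by rewrite raddfB /= dc de subr0.
by apply/forallP => q; rewrite raddfB /= (eqP (ic q)) (eqP (ie q)).
Qed.

HB.instance Definition _ :=
  GRing.isZmodClosed.Build (chain G A i) inv_cycle inv_cycle_zmod_closed.

Record invCycle := InvCycle {
  cycle_val :> chain G A i;
  _ : cycle_val \in inv_cycle
}.
HB.instance Definition _ := [isSub for cycle_val].
HB.instance Definition _ := [Choice of invCycle by <:].
HB.instance Definition _ := [SubChoice_isSubZmodule of invCycle by <:].

End EquivariantHomology.

Arguments inv_chain {Q G} to A i _.
Arguments inv_cycle {Q G} to A i _.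

Section EquivariantHomologyQuotient.
Variables (Q : finGroupType) (G : groupType) (to : autAction Q G).
Variables (A : zmodType) (i : nat).

(* Only boundaries of invariant chains count.  As d o d = 0 and d commutes with
   Q, every such boundary is an invariant cycle. *)
Definition inv_boundary : {pred invCycle to A i} :=
  [pred z | `[< exists2 b : chain G A i.+1,
                  b \in inv_chain to A i.+1 & boundary b = val z >]].

Lemma inv_boundary_zmod_closed : zmod_closed inv_boundary.
Proof.
split=> [|z w]; rewrite !inE.
  apply/asboolP; exists 0; last by rewrite !raddf0.
  by rewrite inE; apply/forallP => q; rewrite raddf0.
move=> /asboolP[b ib db] /asboolP[c ic dc]; apply/asboolP; exists (b - c).
  move: ib ic; rewrite !inE => /forallP ib /forallP ic.
  by apply/forallP => q; rewrite raddfB /= (eqP (ib q)) (eqP (ic q)).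
by rewrite !raddfB /= db dc.
Qed.

HB.instance Definition _ :=
  GRing.isZmodClosed.Build (invCycle to A i) inv_boundary inv_boundary_zmod_closed.

(* H_i^Q(G; A), the homology of the complex of Q-invariant chains. *)
Definition equiv_homology : zmodType := Quotient.quot inv_boundary.

End EquivariantHomologyQuotient.

Arguments inv_boundary {Q G} to A i _.

(* Main.v *)
Require Import Defs.
From HB Require Import structures.
From mathcomp Require Import all_boot all_order all_fingroup all_algebra.
From mathcomp Require Import finmap boolp monalg.

Set Implicit Arguments.
Unset Strict Implicit.
Unset Printing Implicit Defensive.

Import GRing.Theory.
Local Open Scope ring_scope.

(** In the bar complex, the classical contraction [c |-> [h|c]] fails to be a
    homotopy from the identity to zero only through the terms

      [h g_1|g_2|...|g_i]   and   [h|g_2|...|g_i],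

    which come from the face of [h|g_1|...|g_i] that multiplies h into g_1 and
    from the face of [g_1|...|g_i] that forgets g_1.  When G is finite, summing
    over all h in G makes these two families cancel, since h |-> h g_1 permutes
    G.  Hence for i > 0 the map

      s [g_1|...|g_i] = \sum_(h in G) [h|g_1|...|g_i]

    satisfies  d s + s d = |G|  (lemma [cone_sum_homotopy]).  The elements of Q
    also permute G, so s commutes with Q and preserves invariant chains (lemma
    [cone_sum_equivariant]).  If z is an invariant cycle, then |G| z = d (s z)
    is therefore the boundary of an invariant chain. *)

(** * Additive maps on chains *)

Section AdditiveMaps.
Variables (K : choiceType) (A : zmodType).

Lemma malg_additive_ext (B : zmodType) (f g : {additive {malg A[K]} -> B}) :
  (forall a k, f << a *g k >> = g << a *g k >>) -> f =1 g.
Proof.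
move=> eq_fg c; rewrite [c]monalgE !raddf_sum.
by apply: eq_bigr => k _; apply: eq_fg.
Qed.

Lemma malg_tensorEw (x : {malg int[K]}) (a : A) (D : {fset K}) :
  {subset msupp x <= D} ->
  malg_tensor x a = \sum_(k <- D) << a *~ x@_k *g k >>.
Proof.
move=> sD; rewrite /malg_tensor; apply: big_fset_incl; first exact/fsubsetP.
by move=> k _ kNx; rewrite mcoeff_outdom // mulr0z raddf0.
Qed.

Lemma malg_tensorD (x y : {malg int[K]}) (a : A) :
  malg_tensor (x + y) a = malg_tensor x a + malg_tensor y a.
Proof.
pose D := (msupp x `|` msupp y)%fset.
rewrite !(@malg_tensorEw _ a D).
- by rewrite -big_split; apply: eq_bigr => k _; rewrite /= mcoeffD mulrzDr raddfD.
- by move=> k ky; rewrite in_fsetU ky orbT.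
- by move=> k kx; rewrite in_fsetU kx.
- by move=> k; apply/fsubsetP/msuppD_le.
Qed.

Lemma malg_tensorU (n : int) (k : K) (a : A) :
  malg_tensor << n *g k >> a = << a *g k >> *~ n.
Proof.
rewrite (@malg_tensorEw _ a [fset k]%fset); last exact/fsubsetP/msuppU_le.
by rewrite big_seq_fset1 mcoeffUU raddfMz.
Qed.

Lemma malg_tensor_sum (I : Type) (r : seq I) (F : I -> {malg int[K]}) (a : A) :
  malg_tensor (\sum_(j <- r) F j) a = \sum_(j <- r) malg_tensor (F j) a.
Proof.
elim/big_rec2: _ => [|j u v _ <-]; last by rewrite malg_tensorD.
by rewrite (@malg_tensorEw _ a fset0) ?big_seq_fset0 // msupp0.
Qed.

End AdditiveMaps.

(** * Faces of a bar symbol with a new first entry *)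

Section Faces.
Variable G : groupType.

Lemma widen_lift0 n (k : 'I_n) :
  widen_ord (leqnSn n.+1) (lift ord0 k) = lift ord0 (widen_ord (leqnSn n) k).
Proof. exact: val_inj. Qed.

Lemma bar_first_cons n h (g : n.-tuple G) : bar_first (cons_tuple h g) = g.
Proof. by apply: eq_from_tnth => k; rewrite tnth_mktuple tnthS. Qed.

Lemma bar_last_cons n h (g : n.+1.-tuple G) :
  bar_last (cons_tuple h g) = cons_tuple h (bar_last g).
Proof.
apply: eq_from_tnth => k; rewrite tnth_mktuple.
have [k' ->|->] := unliftP ord0 k; last by rewrite [RHS]tnth0 -[RHS](tnth0 h g).
by rewrite widen_lift0 !tnthS tnth_mktuple.
Qed.

Lemma bar_mul_cons0 n h (g : n.+1.-tuple G) :
  bar_mul (cons_tuple h g) ord0 =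
  cons_tuple (h * tnth g ord0)%g (bar_first g).
Proof.
apply: eq_from_tnth => k; rewrite tnth_mktuple.
have [k' ->|->] /= := unliftP ord0 k; first by rewrite !tnthS tnth_mktuple.
by rewrite [RHS]tnth0 tnthS.
Qed.

Lemma bar_mul_consS n h (g : n.+1.-tuple G) (j : 'I_n) :
  bar_mul (cons_tuple h g) (lift ord0 j) = cons_tuple h (bar_mul g j).
Proof.
apply: eq_from_tnth => k; rewrite tnth_mktuple.
have [k' ->|->] := unliftP ord0 k.
  by rewrite widen_lift0 !tnthS tnth_mktuple (inj_eq lift_inj).
by rewrite [RHS]tnth0.
Qed.

End Faces.

(** * Cones and their sum over the group *)

Section Cone.
Variables (G : groupType) (A : zmodType).

Lemma boundaryU (n : nat) (a : A) (g : n.+1.-tuple G) :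
  boundary << a *g g >> =
    << a *g bar_first g >> + \sum_(j < n) << a *g bar_mul g j >> *~ (-1) ^+ j.+1
    + << a *g bar_last g >> *~ (-1) ^+ n.+1.
Proof.
rewrite /boundary malg_extU /= /bar_d !malg_tensorD malg_tensor_sum.
rewrite !malg_tensorU mulr1z; congr (_ + _ + _).
by apply: eq_bigr => j _; rewrite malg_tensorU.
Qed.

Definition cone n (h : G) : chain G A n -> chain G A n.+1 :=
  malg_ext (fun g : n.-tuple G => mkmalgU (cons_tuple h g)).

HB.instance Definition _ n h := GRing.Additive.on (@cone n h).

Lemma coneU n h a (g : n.-tuple G) :
  cone h << a *g g >> = << a *g cons_tuple h g >>.
Proof. exact: malg_extU. Qed.

(** All faces of [h|g_1|...|g_(n+1)] but the first two are cones over faces of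
    [g_1|...|g_(n+1)], with the opposite sign.  The first face is the symbol
    itself, the second face and the cone over [g_2|...|g_(n+1)] stay unmatched. *)
Lemma boundary_cone n h a (g : n.+1.-tuple G) :
  boundary (cone h << a *g g >>) + cone h (boundary << a *g g >>) =
  << a *g g >> + (<< a *g cons_tuple h (bar_first g) >>
                  - << a *g cons_tuple (h * tnth g ord0)%g (bar_first g) >>).
Proof.
rewrite coneU !boundaryU !raddfD /= raddf_sum /=.
rewrite coneU raddfMz /= coneU bar_first_cons bar_last_cons.
rewrite big_ord_recl bar_mul_cons0 expr1 mulrN1z.
set T := \sum_(j < n) cone h _.
have -> : \sum_(j < n) << a *g bar_mul (cons_tuple h g) (lift ord0 j) >>
            *~ (-1) ^+ (lift ord0 j).+1 = - T.
  rewrite -sumrN; apply: eq_bigr => j _.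
  by rewrite lift0 bar_mul_consS raddfMz /= coneU [(-1) ^+ _.+2]exprS mulN1r mulrNz.
rewrite [(-1) ^+ n.+2]exprS mulN1r mulrNz.
set L := _ *~ _; set F := << a *g cons_tuple h (bar_first g) >>.
set M := << a *g cons_tuple (_ * _)%g _ >>.
rewrite -!addrA; congr (_ + _).
by rewrite (addrA (- T)) -opprD [- (T + L) + _]addrC addrK addrC.
Qed.

End Cone.

Section ConeSum.
Variables (G : finGroupType) (A : zmodType).

Definition cone_sum n (c : chain G A n) : chain G A n.+1 :=
  \sum_(h : G) cone h c.

Lemma cone_sum_is_zmod_morphism n : zmod_morphism (@cone_sum n).
Proof. by move=> c e; rewrite -sumrB; apply: eq_bigr => h _; rewrite raddfB. Qed.

HB.instance Definition _ n :=
  GRing.isZmodMorphism.Build (chain G A n) (chain G A n.+1) (@cone_sum n)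
    (@cone_sum_is_zmod_morphism n).

(** The two unmatched terms of [boundary_cone] range over the same symbols when
    h runs through G.  The degree is positive because the permutation
    h |-> h g_1 that matches them uses the entry g_1. *)
Lemma cone_sum_homotopy n (c : chain G A n.+1) :
  boundary (cone_sum c) + cone_sum (boundary c) = c *+ #|G|.
Proof.
pose dssd : {additive _ -> _} :=
  (@boundary G A n.+2 \o @cone_sum n.+1) \+ (@cone_sum n \o @boundary G A n.+1).
rewrite -[LHS]/(dssd c) [c]monalgE raddf_sum -sumrMnl.
apply: eq_bigr => g _; move: c@_g => a.
rewrite /dssd /= /cone_sum raddf_sum -big_split /=.
under eq_bigr do rewrite boundary_cone.
rewrite big_split sumr_const /= cardT -cardE sumrB.
rewrite [X in _ - X](reindex_inj (mulIg (tnth g ord0)^-1%g)) /=.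
under [X in _ - X]eq_bigr do rewrite mulgKV.
by rewrite subrr addr0.
Qed.

End ConeSum.

(** * Equivariance *)

Lemma aut_act_inj (Q G : groupType) (to : autAction Q G) q : injective (to q).
Proof.
apply: (can_inj (g := to q^-1%g)) => g.
by rewrite -aut_actM mulVg aut_act1.
Qed.

Section Equivariance.
Variables (Q G : finGroupType) (to : autAction Q G) (A : zmodType).

Lemma chain_act_cone n q h (c : chain G A n) :
  chain_act to q (cone h c) = cone (to q h) (chain_act to q c).
Proof.
pose lhs : {additive _ -> _} := @chain_act Q G to A n.+1 q \o @cone G A n h.
pose rhs : {additive _ -> _} := @cone G A n (to q h) \o @chain_act Q G to A n q.
rewrite -[LHS]/(lhs c) -[RHS]/(rhs c); apply: malg_additive_ext => a g.
rewrite /lhs /rhs /= coneU /chain_act !malg_extU coneU; congr << _ *g _ >>.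
exact: val_inj.
Qed.

(** The element q turns the summand of index h into the one of index q(h), and
    so merely permutes the summands. *)
Lemma cone_sum_equivariant n q (c : chain G A n) :
  chain_act to q (cone_sum c) = cone_sum (chain_act to q c).
Proof.
rewrite /cone_sum raddf_sum /= [RHS](reindex_inj (@aut_act_inj _ _ to q)).
by apply: eq_bigr => h _; apply: chain_act_cone.
Qed.

Lemma inv_chain_cone_sum n (c : chain G A n) :
  c \in inv_chain to A n -> cone_sum c \in inv_chain to A n.+1.
Proof.
rewrite !inE => /forallP ic; apply/forallP => q.
by rewrite cone_sum_equivariant (eqP (ic q)).
Qed.

End Equivariance.

Theorem proposition4p1 (Q : finGroupType) (G : finGroupType)
    (to : autAction Q G) (A : zmodType) (i : nat) (hi : (0 < i)%N) :
  forall x : equiv_homology to A i, x *+ #|G| = 0.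
Proof.
case: i hi => // n _; elim/quotW => z.
rewrite -raddfMn -(raddf0 (\pi_(equiv_homology to A n.+1))%qT).
apply/eqP; rewrite -Quotient.idealrBE subr0.
have /andP[iz /eqP dz] := valP z.
rewrite inE; apply/asboolP; exists (cone_sum (val z)).
  exact: inv_chain_cone_sum.
by rewrite -[LHS]addr0 -(raddf0 (@cone_sum G A n)) -dz cone_sum_homotopy raddfMn.
Qed.
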